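(* Let $\mathbb K$ be an infinite field of arbitrary characteristic, let $\mathcal Q$ be a quiver with data $\underline n,\alpha,\phi$ satisfying (a)–(c) of the context, and let $\mathcal Q^{(2)},\underline n^{(2)},\alpha^{(2)},\phi^{(2)}$ be the zigzag-quiver data constructed from it in the context. Denote by $x^a_{ij}$ ($a\in\mathcal Q_1$) the coordinate functions on $\mathcal R=\mathcal R_{\alpha,\phi}(\mathcal Q,\underline n)$ and by $y^{c}_{ij}$ ($c\in\mathcal Q^{(2)}_1$) those on $\mathcal R^{(2)}=\mathcal R_{\alpha^{(2)},\phi^{(2)}}(\mathcal Q^{(2)},\underline n^{(2)})$. Let $\Phi:\mathbb K[\mathcal R^{(2)}]\to\mathbb K[\mathcal R]$ be the homomorphism of $\mathbb K$-algebras defined by $$\Phi(y^{c}_{ij})=\begin{cases}x^a_{ij}, & c=\tilde a \text{ is of type }1\ (a\in\mathcal Q_1),\\ \delta_{ij}, & c \text{ is of type }2,\\ x^a_{ji}, & c=\tilde a\text{ is of type }3\ (a\in\mathcal Q_1).\end{cases}$$ Then $\Phi$ restricts to a mapping of the algebras of semi-invariants $$\mathbb K[\mathcal R^{(2)}]^{SL_{\alpha^{(2)},\phi^{(2)}}(\underline n^{(2)})}\longrightarrow \mathbb K[\mathcal R]^{SL_{\alpha,\phi}(\underline n)},$$ and this mapping is surjective.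
   Context: **Mixed representations.** A quiver $\mathcal Q=(\mathcal Q_0,\mathcal Q_1)$ is a finite oriented graph with vertex set $\mathcal Q_0$ and arrow set $\mathcal Q_1$; for an arrow $a$, $a''$ is its tail and $a'$ its head. Let $\underline n=(n_u)_{u\in\mathcal Q_0}$ be a dimension vector, $\alpha=(\alpha_u)_{u\in\mathcal Q_0}$ with $\alpha_u\in\{1,\ast\}$ (the group of order two with identity $1$), and $\phi:\mathcal Q_0\to\mathcal Q_0$ an involution such that: (a) $n_u=n_{\phi(u)}$; (b) $\phi(u)=u$ implies $\alpha_u=1$; (c) $\phi(u)\ne u$ implies $\alpha_{\phi(u)}=\ast\alpha_u$ (i.e. $\{\alpha_u,\alpha_{\phi(u)}\}=\{1,\ast\}$). For an invertible matrix $g$ put $g^{1}=g$, $g^{\ast}=(g^{-1})^T$. Define $$\mathcal R_{\alpha,\phi}(\mathcal Q,\underline n)=\bigoplus_{a\in\mathcal Q_1}\mathbb K^{n_{a'}\times n_{a''}},$$ $$GL_{\alpha,\phi}(\underline n)=\Big\{(g_u)_u\in\prod_{u\in\mathcal Q_0}GL(n_u)\ :\ g_u=g_{\phi(u)}\ \text{for all }u\Big\},$$ acting by $g\cdot(H_a)_a=\big(g_{a'}^{\alpha_{a'}}H_a(g_{a''}^{\alpha_{a''}})^{-1}\big)_a$. Let $SL_{\alpha,\phi}(\underline n)$ be the subgroup of those $g$ with $\det g_u=1$ for all $u$. The coordinate ring $\mathbb K[\mathcal R_{\alpha,\phi}(\mathcal Q,\underline n)]$ is the polynomial ring in the coordinate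 functions $x^a_{ij}$ (sending $H$ to the $(i,j)$ entry of $H_a$), with action $(g\cdot f)(H)=f(g^{-1}\cdot H)$; the $SL_{\alpha,\phi}(\underline n)$-invariant polynomials are the semi-invariants. **Construction of $\mathcal Q^{(2)}$.** Step 0. For each $u\in\mathcal Q_0$ with $\phi(u)=u$ add a new vertex $u^\circ$ with no arrows attached, with $n_{u^\circ}=n_u$, $\alpha_{u^\circ}=\ast$, and redefine $\phi$ to interchange $u$ and $u^\circ$. (Neither the representation space nor the group with its action changes.) Let $\mathcal Q^{(0)}_0$ be the resulting vertex set, on which $\phi$ now has no fixed points. Step 1. The vertex set of $\mathcal Q^{(2)}$ is $\mathcal Q^{(0)}_0\sqcup\{\bar u: u\in\mathcal Q_0^{(0)}\}$, where $\bar u$ is a new vertex for each $u$. Put $n^{(2)}_u=n^{(2)}_{\bar u}=n_u$, $\alpha^{(2)}_u=\alpha^{(2)}_{\bar u}=\alpha_u$, and $\phi^{(2)}(u)=\overline{\phi(u)}$, $\phi^{(2)}(\bar u)=\phi(u)$. Step 2. The arrows of $\mathcal Q^{(2)}$ are: - (type 1) for each $a\in\mathcal Q_1$ not satisfying $\alpha_{a'}=\alpha_{a''}=\ast$, an arrow $\tilde a$ from $\overline{a''}$ to $a'$; - (type 3) for each $a\in\mathcal Q_1$ with $\alpha_{a'}=\alpha_{a''}=\ast$, an arrow $\tilde a$ from $\overline{\phi(a')}$ to $\phi(a'')$; - (type 2) for each $u\in\mathcal Q^{(0)}_0$ with $\alpha_u=1$, an arrow $b_u$ from $\bar u$ to $u$.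 $\delta_{ij}$ is the Kronecker symbol. *)

(* Defs.v *)
From HB Require Import structures.
From mathcomp Require Import all_boot all_order all_algebra.
From mathcomp Require Import mpoly.

Set Implicit Arguments.
Unset Strict Implicit.
Unset Printing Implicit Defensive.

Import GRing.Theory.
Local Open Scope ring_scope.

(* A quiver with a dimension vector, an involution phi of the vertices and    *)
(* exponents alpha_u in the group {1, * } of order two, encoded as booleans:  *)
(* star u = false is alpha_u = 1, star u = true is alpha_u = *, and           *)
(* multiplication by * is negation.  The arrow a goes from tail a to head a.  *)
Record mixed_quiver := MixedQuiver {
  vert : finType;
  arr : finType;
  head : arr -> vert;
  tail : arr -> vert;
  dim : vert -> nat;
  star : vert -> bool;
  phi : vert -> vert;
  phiK : involutive phi;
  dim_phi : forall u, dim (phi u) = dim u;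
  star_fixed : forall u, phi u = u -> star u = false;
  star_phi : forall u, phi u <> u -> star (phi u) = ~~ star u
}.

Section Representations.

Variables (K : fieldType) (Q : mixed_quiver).

Definition rep := forall a : arr Q, 'M[K]_(dim (head a), dim (tail a)).

Definition gfam := forall u : vert Q, 'M[K]_(dim u).

Definition in_GL (g : gfam) : Prop :=
  (forall u, g u \in unitmx) /\
  (forall u, g u = castmx (dim_phi u, dim_phi u) (g (phi u))).

Definition in_SL (g : gfam) : Prop := in_GL g /\ forall u, \det (g u) = 1.

Definition ginv (g : gfam) : gfam := fun u => invmx (g u).

Definition mx_exp n (b : bool) (A : 'M[K]_n) : 'M[K]_n :=
  if b then (invmx A)^T else A.

Definition gexp (g : gfam) (u : vert Q) : 'M[K]_(dim u) :=
  mx_exp (star u) (g u).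

Definition rep_act (g : gfam) (H : rep) : rep :=
  fun a => gexp g (head a) *m H a *m invmx (gexp g (tail a)).

Definition coord := {a : arr Q & 'I_(dim (head a)) * 'I_(dim (tail a))}%type.

(* K[R], with one indeterminate for each element of coord. *)
Definition coord_ring := {mpoly K[#|{: coord}|]}.

Definition mk_coord (a : arr Q) (i : 'I_(dim (head a)))
    (j : 'I_(dim (tail a))) : coord :=
  existT (fun b : arr Q => ('I_(dim (head b)) * 'I_(dim (tail b)))%type)
         a (i, j).

Definition coord_fun (a : arr Q) (i : 'I_(dim (head a)))
    (j : 'I_(dim (tail a))) : coord_ring :=
  'X_(enum_rank (mk_coord i j)).

Definition coord_val (H : rep) (c : coord) : K :=
  H (tag c) (tagged c).1 (tagged c).2.

Definition eval_at (f : coord_ring) (H : rep) : K :=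
  f.@[fun k => coord_val H (enum_val k)].

Lemma eval_coord_fun a (i : 'I_(dim (head a))) (j : 'I_(dim (tail a))) H :
  eval_at (coord_fun i j) H = H a i j.
Proof. by rewrite /eval_at mevalXU enum_rankK. Qed.

(* g . f = f for all g in SL, where (g . f)(H) = f(g^-1 . H); over an infinite *)
(* field, elements of K[R] are equal as soon as they agree at every H.         *)
Definition semi_invariant (f : coord_ring) : Prop :=
  forall g : gfam, in_SL g ->
  forall H : rep, eval_at f (rep_act (ginv g) H) = eval_at f H.

End Representations.

Section Zigzag.

Variable Q : mixed_quiver.

(* Q^(0): inr u is the vertex added for the fixed point u of phi.             *)
Definition vert0 := (vert Q + {u : vert Q | phi u == u})%type.

Definition dim0 (v : vert0) : nat :=
  match v with inl u => dim u | inr u => dim (val u) end.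

Definition star0 (v : vert0) : bool :=
  match v with inl u => star u | inr _ => true end.

Definition phi0 (v : vert0) : vert0 :=
  match v with
  | inl u => if insub u is Some u0 then inr u0 else inl (phi u)
  | inr u => inl (val u)
  end.

Lemma phi0_fixed (u : vert Q) (hu : phi u == u) :
  phi0 (inl u) = inr (exist _ u hu).
Proof. by rewrite /phi0 insubT. Qed.

Lemma phi0_moved (u : vert Q) : phi u != u -> phi0 (inl u) = inl (phi u).
Proof. by move=> hu; rewrite /phi0 insubN. Qed.

Lemma phi0K : involutive phi0.
Proof.
case=> [u|[u hu]]; last exact: phi0_fixed.
have [hu|hu] := boolP (phi u == u); first by rewrite phi0_fixed.
by rewrite !phi0_moved ?phiK // eq_sym.
Qed.

Lemma phi0_neq v : phi0 v <> v.
Proof.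
case: v => [u|[u hu]] //.
have [hu|hu] := boolP (phi u == u); first by rewrite phi0_fixed.
by rewrite phi0_moved // => -[/eqP]; rewrite (negbTE hu).
Qed.

Lemma dim0_phi0 v : dim0 (phi0 v) = dim0 v.
Proof.
case: v => [u|[u hu]] //.
have [hu|hu] := boolP (phi u == u); first by rewrite phi0_fixed.
by rewrite phi0_moved //= dim_phi.
Qed.

Lemma star0_phi0 v : star0 (phi0 v) = ~~ star0 v.
Proof.
case: v => [u|[u hu]] /=; last by rewrite star_fixed //; apply/eqP.
have [hu|hu] := boolP (phi u == u).
  by rewrite insubT /= star_fixed //; apply/eqP.
by rewrite insubN //= star_phi //; apply/eqP.
Qed.

(* inl u is the vertex u, and inr u is the vertex \bar u. *)
Definition vert2 := (vert0 + vert0)%type.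

Definition dim2 (v : vert2) : nat :=
  match v with inl u => dim0 u | inr u => dim0 u end.

Definition star2 (v : vert2) : bool :=
  match v with inl u => star0 u | inr u => star0 u end.

Definition phi2 (v : vert2) : vert2 :=
  match v with inl u => inr (phi0 u) | inr u => inl (phi0 u) end.

Definition both_star (a : arr Q) : bool := star (head a) && star (tail a).

Definition arr2 :=
  ({a : arr Q | ~~ both_star a} + {u : vert0 | ~~ star0 u}
   + {a : arr Q | both_star a})%type.

Definition type1 (a : {a : arr Q | ~~ both_star a}) : arr2 := inl (inl a).
Definition type2 (u : {u : vert0 | ~~ star0 u}) : arr2 := inl (inr u).
Definition type3 (a : {a : arr Q | both_star a}) : arr2 := inr a.

Definition head2 (c : arr2) : vert2 :=
  match c with
  | inl (inl a) => inl (inl (head (val a)))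
  | inl (inr u) => inl (val u)
  | inr a => inl (phi0 (inl (tail (val a))))
  end.

Definition tail2 (c : arr2) : vert2 :=
  match c with
  | inl (inl a) => inr (inl (tail (val a)))
  | inl (inr u) => inr (val u)
  | inr a => inr (phi0 (inl (head (val a))))
  end.

Lemma phi2K : involutive phi2.
Proof. by case=> u /=; rewrite phi0K. Qed.

Lemma dim2_phi2 v : dim2 (phi2 v) = dim2 v.
Proof. by case: v => u; apply: dim0_phi0. Qed.

Lemma star2_fixed v : phi2 v = v -> star2 v = false.
Proof. by case: v. Qed.

Lemma star2_phi2 v : phi2 v <> v -> star2 (phi2 v) = ~~ star2 v.
Proof. by case: v => u _; apply: star0_phi0. Qed.

Definition zigzag : mixed_quiver :=
  @MixedQuiver vert2 arr2 head2 tail2 dim2 star2 phi2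
    phi2K dim2_phi2 star2_fixed star2_phi2.

End Zigzag.

Section Phi.

Variables (K : fieldType) (Q : mixed_quiver).

(* The image of y^c_ij.  For c of type 3, i and j have types                  *)
(* 'I_(n_phi(a'')) and 'I_(n_phi(a')), which are cast to 'I_(n_a'') and       *)
(* 'I_(n_a').                                                                 *)
Definition Phi_coord (c : arr (zigzag Q)) :
    'I_(dim (head c)) -> 'I_(dim (tail c)) -> coord_ring K Q :=
  match c with
  | inl (inl a) => fun i j => @coord_fun K Q (val a) i j
  | inl (inr u) => fun i j => (i == j :> nat)%:R
  | inr a => fun i j =>
      @coord_fun K Q (val a)
        (cast_ord (dim0_phi0 (inl (head (val a)))) j)
        (cast_ord (dim0_phi0 (inl (tail (val a)))) i)
  end.

Definition Phi : coord_ring K (zigzag Q) -> coord_ring K Q :=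
  comp_mpoly [tuple Phi_coord (tagged (enum_val k)).1 (tagged (enum_val k)).2
             | k < #|{: coord (zigzag Q)}|].

HB.instance Definition _ := GRing.LRMorphism.on Phi.

Lemma Phi_coord_fun (c : arr (zigzag Q)) (i : 'I_(dim (head c)))
    (j : 'I_(dim (tail c))) : Phi (coord_fun K i j) = Phi_coord i j.
Proof. by rewrite /Phi comp_mpolyXU -tnth_nth tnth_mktuple enum_rankK. Qed.

End Phi.

(* Main.v *)
Require Import Defs.
From HB Require Import structures.
From mathcomp Require Import all_boot all_order all_algebra.
From mathcomp Require Import mpoly.
Import Defs.

Set Implicit Arguments.
Unset Strict Implicit.
Unset Printing Implicit Defensive.

Import GRing.Theory.
Local Open Scope ring_scope.

(** Write R for the representations of Q and R2 for those of the zigzag quiver.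
The map Phi is restriction of polynomial functions along the affine map
[unfold : R -> R2] that copies the matrix of each arrow of Q (transposed for
arrows of type 3) and puts the identity on each arrow b_u.  The group of R2 is
twice as large as that of R: it carries independent matrices on the sheet of
the vertices u and on the sheet of the vertices \bar u, tied together only by
g_{\bar{phi u}} = g_u.  The smaller group embeds by using the same matrix on
both sheets ([lift]), and [unfold] is equivariant for this embedding
([unfold_act]).  Hence Phi maps semi-invariants to semi-invariants.

For surjectivity a polynomial retraction [fold : R2 -> R] of [unfold] is
enough, provided that it is equivariant for some map [descend] from the large
SL to the small one: then h o fold is a semi-invariant preimage of h.  If b_u
carries an invertible matrix B_u, one can glue the two sheets back together by
multiplying each matrix by inverses of the B_u: on the right when the exponent
at the tail is 1, on the left by an inverse transpose when the exponent at the
head is *.  This is not polynomial, but replacing the inverse of B_u by its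
adjugate makes it so.  Nothing is lost, because all group elements have
determinant one: adj (g B h^-1) = h (adj B) g^-1 for det g = det h = 1 and
every B, singular or not ([adjM], [adj_det1]).  This gives the equivariance
([fold_act]), and adj 1 = 1 gives that [fold] retracts [unfold]
([fold_unfold]).

Both maps are defined over every commutative ring and commute with ring
morphisms ([map_unfold], [map_fold]).  Evaluating them at the generic
representation, whose entries are the indeterminates, turns them into
substitutions of polynomials, so that Phi (h o fold) = h is an identity of
polynomials and not only of functions. *)

(** * Matrices: casts, exponents and adjugates *)

(** Moves an equality of indices out of the dependent type of a family of
matrices: it is what makes rewriting with an equation between vertices
possible. *)
Lemma castmx_family (R T : Type) (d : T -> nat) (F : forall t, 'M[R]_(d t)) t t'
    (m : nat) (e : d t = m) (e' : d t' = m) :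
  t = t' -> castmx (e, e) (F t) = castmx (e', e') (F t').
Proof.
by move=> tt'; case: t' / tt' e' => e'; rewrite (eq_irrelevance e e').
Qed.

Lemma castmx_mul (R : comNzRingType) m n p m' n' p' (em : m = m') (en : n = n')
    (ep : p = p') (A : 'M[R]_(m, n)) (B : 'M[R]_(n, p)) :
  castmx (em, ep) (A *m B) = castmx (em, en) A *m castmx (en, ep) B.
Proof. by case: m' / em; case: n' / en; case: p' / ep. Qed.

Lemma castmx_inv (R : comUnitRingType) n n' (e : n = n') (A : 'M[R]_n) :
  castmx (e, e) (invmx A) = invmx (castmx (e, e) A).
Proof. by case: n' / e. Qed.

Lemma castmx_mx_exp (K : fieldType) n n' (e : n = n') b (A : 'M[K]_n) :
  castmx (e, e) (mx_exp b A) = mx_exp b (castmx (e, e) A).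
Proof. by case: n' / e. Qed.

Lemma castmx1 (R : comNzRingType) n n' (e : n = n') :
  castmx (e, e) 1%:M = 1%:M :> 'M[R]_n'.
Proof. by case: n' / e. Qed.

Lemma mx_expN (K : fieldType) n b (A : 'M[K]_n) :
  mx_exp (~~ b) A = (invmx (mx_exp b A))^T.
Proof. by case: b; rewrite /mx_exp //= -trmx_inv trmxK invmxK. Qed.

Lemma mx_exp_unit (K : fieldType) n b (A : 'M[K]_n) :
  A \in unitmx -> mx_exp b A \in unitmx.
Proof. by case: b; rewrite /mx_exp // unitmx_tr unitmx_inv. Qed.

Lemma det_mx_exp (K : fieldType) n b (A : 'M[K]_n) :
  \det A = 1 -> \det (mx_exp b A) = 1.
Proof. by case: b; rewrite /mx_exp // det_tr det_inv => ->; rewrite invr1. Qed.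

Lemma adj_det1 (K : fieldType) n (A : 'M[K]_n) : \det A = 1 -> \adj A = invmx A.
Proof. by move=> detA; rewrite /invmx unitmxE detA unitr1 invr1 scale1r. Qed.

Lemma adjM_regular (R : idomainType) n (A B : 'M[R]_n) :
  \det A != 0 -> \det B != 0 -> \adj (A *m B) = \adj B *m \adj A.
Proof.
move=> detA detB.
have detAB : \det (A *m B) != 0 by rewrite det_mulmx mulf_neq0.
have E : \det (A *m B) *: \adj (A *m B) = \det (A *m B) *: (\adj B *m \adj A).
  rewrite -!mul_scalar_mx -[in RHS]mul_adj_mx -!mulmxA [B *m _]mulmxA.
  rewrite mul_mx_adj [in RHS]mul_scalar_mx -scalemxAr mul_mx_adj.
  rewrite scale_scalar_mx mul_mx_scalar mul_scalar_mx det_mulmx.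
  by rewrite [\det B * _]mulrC.
apply/matrixP=> i j; apply: (mulfI detAB).
by move/matrixP/(_ i j): E; rewrite [in X in X -> _]mxE => ->; rewrite mxE.
Qed.

(** Both sides are polynomial in the entries, so it is enough to treat generic
matrices: A and B are the values at 0 of A + 'X and B + 'X, whose determinants
are monic polynomials and hence nonzero. *)
Lemma adjM (R : idomainType) n (A B : 'M[R]_n) :
  \adj (A *m B) = \adj B *m \adj A.
Proof.
pose at0 (C : 'M[{poly R}]_n) := map_mx (horner_eval 0) C.
(* char_poly_mx (- C) is 'X + C. *)
have at0K C : at0 (char_poly_mx (- C)) = C.
  apply/matrixP=> i j; rewrite !mxE /horner_eval /= !hornerE /=.
  by rewrite hornerMn hornerX mul0rn add0r opprK.
have reg C : \det (char_poly_mx (- C)) != 0 :> {poly R}.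
  exact/monic_neq0/char_poly_monic.
have := congr1 at0 (adjM_regular (reg _ A) (reg _ B)).
by rewrite /at0 map_mxM !map_mx_adj map_mxM -!/(at0 _) !at0K.
Qed.

(** * The retraction of R2 onto R *)

Section MatrixFamilies.

(** The entries range over an arbitrary type, so that a family can be a
representation over K or have polynomials as entries. *)
Definition mxfam (A : Type) (Q : mixed_quiver) :=
  forall a : arr Q, 'M[A]_(dim (head a), dim (tail a)).

Variables (A : comNzRingType) (Q : mixed_quiver).

Definition unfold (H : mxfam A Q) : mxfam A (zigzag Q) :=
  fun c => match c with
  | inl (inl a) => H (val a)
  | inl (inr u) => 1%:M
  | inr a => (castmx (esym (dim0_phi0 (inl (head (val a)))),
                      esym (dim0_phi0 (inl (tail (val a))))) (H (val a)))^T
  end.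

Variable Z : mxfam A (zigzag Q).

Definition arrow_part (a : arr Q) : 'M[A]_(dim (head a), dim (tail a)) :=
  match @idP (both_star a) with
  | ReflectT ha => (castmx (dim0_phi0 (inl (tail a)), dim0_phi0 (inl (head a)))
                      (Z (type3 (exist _ a ha))))^T
  | ReflectF ha => Z (type1 (exist _ a (introT negP ha)))
  end.

(** The factor contributed by the tail of an arrow: it turns the action of the
bar sheet at v into that of the descended element.  No correction is needed
when the exponent at v is *, as the descended element is then taken from the
bar sheet. *)
Definition right_part (v : vert0 Q) : 'M[A]_(dim0 v) :=
  match @idP (~~ star0 v) with
  | ReflectT hv => \adj (Z (type2 (exist _ v hv)))
  | ReflectF _ => 1%:M
  end.

(** The factor contributed by the head.  Since phi exchanges the two sheets and
negates exponents, the correction at v is the contragredient of the one at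
phi v. *)
Definition left_part (v : vert0 Q) : 'M[A]_(dim0 v) :=
  (castmx (dim0_phi0 v, dim0_phi0 v) (right_part (phi0 v)))^T.

Definition fold : mxfam A Q := fun a =>
  left_part (inl (head a)) *m arrow_part a *m right_part (inl (tail a)).

End MatrixFamilies.

Lemma eq_unfold (A : comNzRingType) (Q : mixed_quiver) (H H' : mxfam A Q) :
  (forall a, H a = H' a) -> forall c, unfold H c = unfold H' c.
Proof. by move=> HH' [[a|u]|a] //=; rewrite HH'. Qed.

Lemma eq_fold (A : comNzRingType) (Q : mixed_quiver)
    (Z Z' : mxfam A (zigzag Q)) :
  (forall c, Z c = Z' c) -> forall a, fold Z a = fold Z' a.
Proof.
move=> ZZ' a.
have eqR v : right_part Z v = right_part Z' v.
  by rewrite /right_part; case: {-}_ / idP => hv; rewrite ?ZZ'.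
have eqN : arrow_part Z a = arrow_part Z' a.
  by rewrite /arrow_part; case: {-}_ / idP => ha; rewrite ZZ'.
by rewrite /fold /left_part eqN !eqR.
Qed.

Lemma map_fold (A B : comNzRingType) (f : {rmorphism A -> B}) (Q : mixed_quiver)
    (Z : mxfam A (zigzag Q)) (a : arr Q) :
  map_mx f (fold Z a) = fold (fun c => map_mx f (Z c)) a.
Proof.
have mapR v :
    map_mx f (right_part Z v) = right_part (fun c => map_mx f (Z c)) v.
  by rewrite /right_part; case: {-}_ / idP => hv; rewrite ?map_mx_adj ?map_mx1.
rewrite /fold !map_mxM /left_part -map_trmx map_castmx !mapR.
congr (_ *m _ *m _); last exact: (mapR (inl (tail a))).
rewrite /arrow_part.
by case: {-}_ / idP => ha //; rewrite -map_trmx map_castmx.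
Qed.

Lemma fold_unfold (A : comNzRingType) (Q : mixed_quiver) (H : mxfam A Q) a :
  fold (unfold H) a = H a.
Proof.
have R1 v : right_part (unfold H) v = 1%:M.
  by rewrite /right_part; case: {-}_ / idP => hv //=; rewrite adj1.
rewrite /fold /left_part !R1 castmx1 trmx1 mul1mx mulmx1 /arrow_part.
case: {-}_ / idP => ha //=.
by rewrite trmx_cast trmxK /= castmx_comp castmx_id.
Qed.

Lemma map_unfold (A B : comNzRingType) (f : {rmorphism A -> B})
    (Q : mixed_quiver) (H : mxfam A Q) c :
  map_mx f (unfold H c) = unfold (fun a => map_mx f (H a)) c.
Proof.
case: c => [[a|u]|a] //=; first exact: map_mx1.
by rewrite -map_trmx map_castmx.
Qed.

(** * Equivariance *)

Section Equivariance.

Variables (K : fieldType) (Q : mixed_quiver).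

Lemma gexp_unit (Q' : mixed_quiver) (g : gfam K Q') u :
  in_GL g -> gexp g u \in unitmx.
Proof. by case=> gU _; exact: mx_exp_unit. Qed.

(** Opposite exponents at u and phi u make the exponentiated matrices
contragredient to each other. *)
Lemma gexp_phi (Q' : mixed_quiver) (g : gfam K Q') u
    (e : dim (phi u) = dim u) : in_GL g -> phi u <> u ->
  castmx (e, e) (gexp g (phi u)) = (invmx (gexp g u))^T.
Proof.
case=> _ gphi hu; rewrite /gexp castmx_mx_exp (eq_irrelevance e (dim_phi u)).
by rewrite -gphi star_phi // mx_expN.
Qed.

(** The action at v on the original sheet, with its dimension written [dim0 v]
so that the cast along [phi0] typechecks; [gbar] is the same for the bar
sheet. *)
Definition gtop (g : gfam K (zigzag Q)) (v : vert0 Q) : 'M[K]_(dim0 v) :=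
  gexp g (inl v : vert (zigzag Q)).

Definition gbar (g : gfam K (zigzag Q)) (v : vert0 Q) : 'M[K]_(dim0 v) :=
  gexp g (inr v : vert (zigzag Q)).

Lemma gtop_phi g v : in_GL g ->
  castmx (dim0_phi0 v, dim0_phi0 v) (gtop g (phi0 v)) = (invmx (gbar g v))^T.
Proof.
by move=> gGL; apply: (@gexp_phi (zigzag Q) g (inr v) (dim0_phi0 v)).
Qed.

Lemma gbar_phi g v : in_GL g ->
  castmx (dim0_phi0 v, dim0_phi0 v) (gbar g (phi0 v)) = (invmx (gtop g v))^T.
Proof.
by move=> gGL; apply: (@gexp_phi (zigzag Q) g (inl v) (dim0_phi0 v)).
Qed.

Lemma gtop_unit g v : in_GL g -> gtop g v \in unitmx.
Proof. exact: (@gexp_unit (zigzag Q) g (inl v)). Qed.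

Lemma gbar_unit g v : in_GL g -> gbar g v \in unitmx.
Proof. exact: (@gexp_unit (zigzag Q) g (inr v)). Qed.

Definition lift0 (g : gfam K Q) (v : vert0 Q) : 'M[K]_(dim0 v) :=
  match v with inl u => g u | inr u => g (val u) end.

Definition lift (g : gfam K Q) : gfam K (zigzag Q) :=
  fun v => match v with inl v | inr v => lift0 g v end.

Lemma lift0_phi (g : gfam K Q) v w (e : dim0 w = dim0 v) : in_GL g ->
  phi0 v = w -> lift0 g v = castmx (e, e) (lift0 g w).
Proof.
case=> _ gphi vw; case: w / vw e; case: v => [u|[u hu]] e.
  have [hu|hu] := boolP (phi u == u).
    rewrite (castmx_family (lift0 g) e
               (erefl : dim0 (inr (exist _ u hu)) = dim u)).
      by rewrite castmx_id.
    exact: phi0_fixed.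
  rewrite (castmx_family (lift0 g) e (dim_phi u : dim0 (inl (phi u)) = dim u)).
    exact: gphi.
  exact: phi0_moved.
by rewrite castmx_id.
Qed.

Lemma lift_SL (g : gfam K Q) : in_SL g -> in_SL (lift g).
Proof.
move=> [gGL gdet]; have [gU _] := gGL.
split; [split|]; case=> v; try exact: (lift0_phi _ gGL erefl);
  by case: v => u /=.
Qed.

Lemma unfold_act (g : gfam K Q) (H : rep K Q) c : in_SL g ->
  unfold (rep_act g H) c = rep_act (lift g) (unfold H) c.
Proof.
move=> gSL; have [lGL _] := lift_SL gSL.
case: c => [[a|u]|[a ha]]; first by [].
  rewrite [LHS]/unfold [RHS]/rep_act mulmx1.
  by symmetry; apply/mulmxV/(gtop_unit _ lGL).
transitivity (gtop (lift g) (phi0 (inl (tail a)))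
    *m unfold H (type3 (exist _ a ha))
    *m invmx (gbar (lift g) (phi0 (inl (head a))))); last by [].
set et := dim0_phi0 (inl (tail a)); set eh := dim0_phi0 (inl (head a)).
have -> : gtop (lift g) (phi0 (inl (tail a))) =
    (castmx (esym et, esym et) (invmx (gbar (lift g) (inl (tail a)))))^T.
  by rewrite trmx_cast -gtop_phi // castmx_comp castmx_id.
have -> : gbar (lift g) (phi0 (inl (head a))) =
    (castmx (esym eh, esym eh) (invmx (gtop (lift g) (inl (head a)))))^T.
  by rewrite trmx_cast -gbar_phi // castmx_comp castmx_id.
rewrite !castmx_inv -trmx_inv invmxK -!trmx_mul mulmxA.
by rewrite -castmx_inv -!castmx_mul.
Qed.

(** The choice of sheet is forced by the symmetry under phi: the original sheet
at a vertex with exponent 1 is tied to the bar sheet at its image, whose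
exponent is *. *)
Definition descend (g : gfam K (zigzag Q)) : gfam K Q := fun u =>
  if star u then g (inr (inl u)) else g (inl (inl u)).

Lemma descend_SL g : in_SL g -> in_SL (descend g).
Proof.
move=> [[gU gphi] gdet]; split; [split|] => u.
- rewrite /descend; case: (star u); first exact: (gU (inr (inl u))).
  exact: (gU (inl (inl u))).
- have [hu|hu] := boolP (phi u == u).
    rewrite (@castmx_family _ _ (@dim Q) _ _ u _ (dim_phi u) erefl).
      by rewrite castmx_id.
    exact/eqP.
  rewrite /descend star_phi; last exact/eqP.
  have E := phi0_moved hu.
  case: (star u); rewrite gphi /=.
    exact: (@castmx_family _ _ (@dim0 Q) (fun v => g (inl v)) _ _ _ _ _ E).
  exact: (@castmx_family _ _ (@dim0 Q) (fun v => g (inr v)) _ _ _ _ _ E).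
- rewrite /descend; case: (star u); first exact: (gdet (inr (inl u))).
  exact: (gdet (inl (inl u))).
Qed.

(** The action of [descend g], defined at all vertices of Q^(0) and not only at
those of Q, since [left_part] refers to phi0. *)
Definition gdesc (g : gfam K (zigzag Q)) (v : vert0 Q) : 'M[K]_(dim0 v) :=
  if star0 v then gbar g v else gtop g v.

Lemma gdescE g u : gexp (descend g) u = gdesc g (inl u).
Proof.
by rewrite /gdesc /gexp /descend /gbar /gtop /gexp /=; case: (star u).
Qed.

Lemma gdesc_phi g v : in_GL g ->
  castmx (dim0_phi0 v, dim0_phi0 v) (gdesc g (phi0 v)) = (invmx (gdesc g v))^T.
Proof.
move=> gGL; rewrite /gdesc star0_phi0.
by case: (star0 v); [exact: gtop_phi | exact: gbar_phi].
Qed.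

(** Here determinant one is used: only then is the adjugate of a group element
its inverse.  When the exponent at v is *, both sides are the identity. *)
Lemma right_part_act (g : gfam K (zigzag Q)) (Z : rep K (zigzag Q)) v :
  in_SL g ->
  right_part (rep_act g Z) v = gbar g v *m right_part Z v *m invmx (gdesc g v).
Proof.
move=> [gGL gdet].
have dtop : \det (gtop g v) = 1 by apply/det_mx_exp/(gdet (inl v)).
have dbar : \det (gbar g v) = 1 by apply/det_mx_exp/(gdet (inr v)).
rewrite /right_part /gdesc; case: {-}_ / idP => hv.
  transitivity (\adj (gtop g v *m Z (type2 (exist _ v hv))
                        *m invmx (gbar g v))).
    by [].
  rewrite !adjM (adj_det1 dtop) adj_det1 ?det_inv ?dbar ?invr1 // invmxK.
  by rewrite (negbTE hv) mulmxA.
have -> : star0 v by apply/negPn/negP.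
by rewrite mulmx1 mulmxV //; apply: gbar_unit.
Qed.

Lemma left_part_act (g : gfam K (zigzag Q)) (Z : rep K (zigzag Q)) v :
  in_SL g ->
  left_part (rep_act g Z) v = gdesc g v *m left_part Z v *m invmx (gtop g v).
Proof.
move=> gSL; have [gGL _] := gSL.
rewrite /left_part right_part_act // !(castmx_mul _ (dim0_phi0 v)).
rewrite castmx_inv gdesc_phi // gbar_phi // !trmx_mul trmxK -trmx_inv invmxK.
by rewrite trmxK mulmxA.
Qed.

(** The matrix of an arrow of type 3 goes from phi of the head to phi of the
tail; after transposition the contragredience of the two sheets gives it the
same transformation rule as in type 1. *)
Lemma arrow_part_act (g : gfam K (zigzag Q)) (Z : rep K (zigzag Q)) a :
  in_GL g ->
  arrow_part (rep_act g Z) a =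
    gtop g (inl (head a)) *m arrow_part Z a *m invmx (gbar g (inl (tail a))).
Proof.
move=> gGL; rewrite /arrow_part; case: {-}_ / idP => // ha.
set et := dim0_phi0 (inl (tail a)); set eh := dim0_phi0 (inl (head a)).
transitivity (castmx (et, eh) (gtop g (phi0 (inl (tail a)))
    *m Z (type3 (exist _ a ha))
    *m invmx (gbar g (phi0 (inl (head a))))))^T; first by [].
rewrite (castmx_mul _ eh) (castmx_mul _ et) castmx_inv gtop_phi // gbar_phi //.
by rewrite !trmx_mul trmxK -trmx_inv invmxK trmxK mulmxA.
Qed.

Lemma fold_act (g : gfam K (zigzag Q)) (Z : rep K (zigzag Q)) a : in_SL g ->
  fold (rep_act g Z) a = rep_act (descend g) (fold Z) a.
Proof.
move=> gSL; have [gGL _] := gSL.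
rewrite /fold left_part_act // right_part_act // arrow_part_act //.
rewrite [RHS]/rep_act !gdescE -!mulmxA.
rewrite (mulKmx (gtop_unit (inl (head a)) gGL)).
by rewrite (mulKmx (gbar_unit (inl (tail a)) gGL)).
Qed.

End Equivariance.

(** * Substitution into the generic representation *)

Section Substitution.

Variables (K : fieldType) (Q : mixed_quiver).

Definition generic : mxfam (coord_ring K Q) Q :=
  fun a => \matrix_(i, j) coord_fun K i j.

Definition subst k (X : mxfam {mpoly K[k]} Q) (f : coord_ring K Q) :
    {mpoly K[k]} :=
  f \mPo [tuple X (tag (enum_val l)) (tagged (enum_val l)).1
                                     (tagged (enum_val l)).2
          | l < #|{: coord Q}|].

Lemma eq_eval_at (f : coord_ring K Q) (H H' : rep K Q) :
  (forall a, H a = H' a) -> eval_at f H = eval_at f H'.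
Proof. by move=> HH'; apply: meval_eq => l; rewrite /coord_val HH'. Qed.

Lemma eq_subst k (X X' : mxfam {mpoly K[k]} Q) f :
  (forall a, X a = X' a) -> subst X f = subst X' f.
Proof.
move=> XX'; congr comp_mpoly; apply: eq_from_tnth => l.
by rewrite !tnth_mktuple XX'.
Qed.

Lemma meval_subst k (X : mxfam {mpoly K[k]} Q) (v : 'I_k -> K) f :
  (subst X f).@[v] = eval_at f (fun a => map_mx (meval v) (X a)).
Proof.
rewrite /subst comp_mpoly_meval; apply: meval_eq => l.
by rewrite tnth_mktuple /coord_val mxE.
Qed.

Lemma comp_subst k m (t : k.-tuple {mpoly K[m]}) (X : mxfam {mpoly K[k]} Q) f :
  subst X f \mPo t = subst (fun a => map_mx (comp_mpoly t) (X a)) f.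
Proof.
rewrite /subst [LHS](congr1 _ (comp_mpolyEX _ _)) raddf_sum [RHS]comp_mpolyEX.
apply: eq_bigr => m0 _; rewrite /= comp_mpolyZ; congr (_ *: _).
rewrite !comp_mpolyX rmorph_prod; apply: eq_bigr => l _.
by rewrite rmorphXn /= !tnth_mktuple mxE.
Qed.

Lemma subst_generic (f : coord_ring K Q) : subst generic f = f.
Proof.
rewrite -[RHS]comp_mpoly_id; congr comp_mpoly; apply: eq_from_tnth => l.
rewrite !tnth_mktuple mxE /coord_fun; congr ('X_ _).
rewrite -[RHS]enum_valK; congr enum_rank.
by case: (enum_val l) => a [].
Qed.

End Substitution.

Arguments generic K Q _ : clear implicits.

Lemma meval_generic (K : fieldType) (Q : mixed_quiver) (H : rep K Q) a :
  map_mx (meval (fun l => coord_val H (enum_val l))) (generic K Q a) = H a.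
Proof. by apply/matrixP=> i j; rewrite !mxE; exact: eval_coord_fun. Qed.

Lemma Phi_generic (K : fieldType) (Q : mixed_quiver) c :
  map_mx (@Phi K Q) (generic K (zigzag Q) c) = unfold (generic K Q) c.
Proof.
apply/matrixP=> i j; rewrite !mxE Phi_coord_fun.
case: c i j => [[a|u]|a] i j /=; rewrite ?mxE //.
by rewrite castmxE mxE; congr coord_fun; exact: val_inj.
Qed.

Lemma Phi_subst (K : fieldType) (Q : mixed_quiver)
    (f : coord_ring K (zigzag Q)) :
  Phi f = subst (unfold (generic K Q)) f.
Proof.
rewrite -[in LHS](subst_generic f) [LHS]comp_subst.
by apply: eq_subst => c; exact: Phi_generic.
Qed.

(** Phi is the comorphism of [unfold]. *)
Lemma eval_Phi (K : fieldType) (Q : mixed_quiver) (f : coord_ring K (zigzag Q))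
    (H : rep K Q) : eval_at (Phi f) H = eval_at f (unfold H).
Proof.
rewrite Phi_subst [LHS]meval_subst; apply: eq_eval_at => c.
rewrite map_unfold; apply: eq_unfold; exact: meval_generic.
Qed.

Lemma ginv_SL (K : fieldType) (Q : mixed_quiver) (g : gfam K Q) :
  in_SL g -> in_SL (ginv g).
Proof.
move=> [[gU gphi] gdet]; split; [split|] => u; rewrite /ginv.
- by rewrite unitmx_inv.
- by rewrite castmx_inv -gphi.
- by rewrite det_inv gdet invr1.
Qed.

(** The action through g^-1 in the definition can be replaced by the action
through g, as SL is closed under inversion. *)
Lemma semi_invariantP (K : fieldType) (Q : mixed_quiver) (f : coord_ring K Q) :
  semi_invariant f <-> forall g, in_SL g ->
    forall H, eval_at f (rep_act g H) = eval_at f H.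
Proof.
split=> finv g gSL H; last exact/finv/ginv_SL.
rewrite -[RHS](finv _ (ginv_SL gSL)); apply: eq_eval_at => a.
by rewrite /rep_act /gexp /ginv !invmxK.
Qed.

(** * Phi on semi-invariants *)

Theorem theorem7 (K : fieldType)
    (K_infinite : forall s : seq K, exists x : K, x \notin s)
    (Q : mixed_quiver) :
  (forall f : coord_ring K (zigzag Q),
     semi_invariant f -> semi_invariant (Phi f)) /\
  (forall h : coord_ring K Q, semi_invariant h ->
     exists2 f : coord_ring K (zigzag Q), semi_invariant f & Phi f = h).
Proof.
split=> [f /semi_invariantP finv | h /semi_invariantP hinv].
  apply/semi_invariantP => g gSL H; rewrite !eval_Phi.
  rewrite -[RHS](finv _ (lift_SL gSL)); apply: eq_eval_at => c.
  exact: unfold_act.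
exists (subst (fold (generic K (zigzag Q))) h); last first.
  rewrite /Phi comp_subst.
  rewrite -[RHS]subst_generic; apply: eq_subst => a.
  rewrite [LHS]map_fold (eq_fold (@Phi_generic K Q)); exact: fold_unfold.
have eval_f Z : eval_at (subst (fold (generic K (zigzag Q))) h) Z =
    eval_at h (fold Z).
  rewrite [LHS]meval_subst; apply: eq_eval_at => a.
  by rewrite map_fold; apply: eq_fold; exact: meval_generic.
apply/semi_invariantP => g gSL Z; rewrite !eval_f.
rewrite -[RHS](hinv _ (descend_SL gSL)); apply: eq_eval_at => a.
exact: fold_act.
Qed.
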